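(* Suppose $\mathfrak{a}\in C^2(\mathbb{R})$ is strictly increasing and strictly convex, let $\mathfrak{F}$ be an antiderivative of $\mathfrak{a}$, and let $$\mathcal{K}_1:=\left\{\begin{pmatrix} u & v\\ \mathfrak{a}(v) & u\\ u\,\mathfrak{a}(v) & \frac12u^2+\mathfrak{F}(v)\end{pmatrix}: u,v\in\mathbb{R}\right\}\subset M^{3\times 2}.$$ Then $\mathcal{K}_1$ does not contain $\mathbb{T}_4$ configurations, i.e. no ordered set of four matrices of $\mathcal{K}_1$ forms a $\mathbb{T}_4$ configuration.
   Context: $M^{m\times n}$ is the set of real $m\times n$ matrices. Two matrices $A,B$ are Rank-1 connected if $\mathrm{Rank}(A-B)=1$. An ordered set of $N\geq 4$ (pairwise distinct) matrices $\{T_i\}_{i=1}^N\subset M^{m\times n}$ without Rank-1 connections (no two of them are Rank-1 connected) is said to form a $\mathbb{T}_N$ configuration if there exist matrices $P,C_1,\dots,C_N\in M^{m\times n}$ and numbers $\kappa_i>1$ such that $T_i=P+C_1+\dots+C_{i-1}+\kappa_iC_i$ for $i=1,\dots,N$ (so $T_1=P+\kappa_1C_1$), where $\mathrm{Rank}(C_i)=1$ for all $i$ and $\sum_{i=1}^NC_i=0$. *)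

(* Defs.v *)
From HB Require Import structures.
From mathcomp Require Import all_boot all_order all_algebra.
From mathcomp Require Import all_classical all_reals all_analysis.
Import Order.TTheory GRing.Theory Num.Theory.
Import numFieldNormedType.Exports.

Set Implicit Arguments.
Unset Strict Implicit.
Unset Printing Implicit Defensive.

Local Open Scope classical_set_scope.
Local Open Scope ring_scope.

(* The derivability conditions are needed because [f^`(n)] is total: it has a
   junk value where [f] is not [n] times derivable. *)
Definition C2_fun (R : realType) (f : R -> R) : Prop :=
  [/\ forall x : R, derivable f x 1,
      forall x : R, derivable (f^`())%classic x 1
    & continuous (f^`(2))%classic].

Definition strictly_increasing (R : realType) (f : R -> R) : Prop :=
  {homo f : x y / x < y}.

Definition strictly_convex (R : realType) (f : R -> R) : Prop :=
  forall x y t : R, x != y -> 0 < t -> t < 1 ->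
    f (t * x + (1 - t) * y) < t * f x + (1 - t) * f y.

Definition antiderivative (R : realType) (F f : R -> R) : Prop :=
  forall x : R, is_derive x (1 : R) F (f x).

Definition rank1_connected (R : realType) (m n : nat) (A B : 'M[R]_(m, n)) :
    Prop :=
  \rank (A - B) = 1%N.

(* The ordered set is the family [T], indexed from [0] instead of [1]. *)
Definition TN_configuration (R : realType) (m n N : nat)
    (T : 'I_N -> 'M[R]_(m, n)) : Prop :=
  [/\ (4 <= N)%N,
      injective T,
      forall i j : 'I_N, ~ rank1_connected (T i) (T j)
    & exists (P : 'M[R]_(m, n)) (C : 'I_N -> 'M[R]_(m, n)) (kappa : 'I_N -> R),
        [/\ forall i : 'I_N, 1 < kappa i,
            forall i : 'I_N,
              T i = P + \sum_(j < N | (j < i)%N) C j + kappa i *: C i,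
            forall i : 'I_N, \rank (C i) = 1%N
          & \sum_(i < N) C i = 0]].

Definition K1_mx (R : realType) (a F : R -> R) (u v : R) : 'M[R]_(3, 2) :=
  \matrix_(i < 3, j < 2)
    nth 0 (nth [::] [:: [:: u; v];
                        [:: a v; u];
                        [:: u * a v; u ^+ 2 / 2 + F v]] i) j.

Definition K1 (R : realType) (a F : R -> R) : set 'M[R]_(3, 2) :=
  [set M | exists u v : R, M = K1_mx a F u v].

(* Main.v *)
Require Import Defs.
From mathcomp Require Import all_boot all_order all_algebra.
From mathcomp Require Import all_classical all_reals all_analysis.
From mathcomp Require Import ring lra.
Import Order.TTheory GRing.Theory Num.Theory.
Import numFieldNormedType.Exports.
Set Implicit Arguments.
Unset Strict Implicit.
Unset Printing Implicit Defensive.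
Local Open Scope classical_set_scope.
Local Open Scope ring_scope.

(* A 2x2 minor is affine along rank-one segments, so going around the cycle of a
   T_N configuration yields, for each k, positive weights w_j such that
   sum_j w_j M(T_j - T_k) = 0 for every 2x2 minor M, with the same weights for all
   minors.  For matrices of K_1 put
     E_ij = (u_i - u_j)^2 + 2 (F(v_i) - F(v_j) - a(v_i) (v_i - v_j));
   the three balance equations at k become
     sum w_j (E_kj + E_jk) = sum w_j (u_k - u_j) E_jk
                           = sum w_j (a(v_k) - a(v_j)) E_kj = 0.
   The half sum D_ij = (u_i - u_j)^2 - (v_i - v_j) (a(v_i) - a(v_j)) is the
   Lorentzian form of the difference of the points (u, v, a(v)), and strict
   convexity of a gives E_ij > E_ji when v_i < v_j.

   Number the points by increasing v.  Only the equations at k = 1 and k = 4 are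
   needed.  They fix the signs of most of the E_1j and E_4j, by comparison of the
   a(v_j) in the last equation.  If the points 1 and 4 are spacelike separated
   (D_14 >= 0), then 1, 3 are timelike, 3, 4 spacelike and 2, 4 timelike separated.
   If D_14 < 0, then 2, 4 are spacelike and 3, 4 timelike separated.  In both cases
   a suitable combination of the three equations at k = 4 is a sum of nonnegative
   terms, one of them positive. *)

(** * Balanced minors of T_N configurations *)

Definition minor2 (R : realType) (m n : nat) (i1 i2 : 'I_m) (j1 j2 : 'I_n)
    (X : 'M[R]_(m, n)) : R :=
  X i1 j1 * X i2 j2 - X i1 j2 * X i2 j1.

Lemma minor2_rank1 (R : realType) m n (C : 'M[R]_(m, n)) i1 i2 j1 j2 :
  \rank C = 1%N -> minor2 i1 i2 j1 j2 C = 0.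
Proof.
move=> rkC; rewrite /minor2.
move: (col_base C) (row_base C) (mulmx_base C); rewrite rkC => U V <-.
by rewrite !mxE !big_ord1; ring.
Qed.

(* With [q j] the value at [P + C_1 + .. + C_j] and [g j] the value at [T_j] of
   a function affine along each [C_j], the quotients of [q j] by the product of
   the [1 - 1 / kappa_l] telescope around the cycle. *)
Lemma cyclic_weights (R : realType) (N k : nat) (t : nat -> R) :
    (forall j, 0 < t j < 1) -> (k < N)%N ->
  exists2 w : nat -> R, forall j, 0 < w j &
    forall q g : nat -> R,
      (forall j, (j < N)%N -> q j.+1 = (1 - t j) * q j + t j * g j) ->
      q N = q 0%N -> q k = 0 -> q k.+1 = 0 -> g k = 0 ->
      \sum_(j < N) w j * g j = 0.
Proof.
move=> t01 kN.
pose pi n := \prod_(l < n) (1 - t l).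
have pi_gt0 n : 0 < pi n.
  by apply: prodr_gt0 => l _; rewrite subr_gt0; have /andP[] := t01 l.
pose lam j := t j / pi j.+1.
have lam_gt0 j : 0 < lam j by rewrite divr_gt0 //; have /andP[] := t01 j.
(* The cycle is cut at [k]. Indices before [k] belong to the next turn, whose quotients carry an
   additional factor [1 / pi N], so that the boundary values at [0] and [N] cancel. *)
exists (fun j => if (j < k)%N then lam j / pi N else lam j).
  by move=> j; case: ifP => _ //; rewrite divr_gt0.
move=> q g qS qN qk qk1 gk.
have tele j : (j < N)%N -> lam j * g j = q j.+1 / pi j.+1 - q j / pi j.
  move=> jN; rewrite qS // /lam /pi big_ord_recr /= -/(pi j).
  have := pi_gt0 j; have /andP[_] := t01 j; rewrite -subr_gt0 => h1 h2.
  by field; rewrite (gt_eqF h1) (gt_eqF h2).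
rewrite -(big_mkord xpredT (fun j => (if (j < k)%N then lam j / pi N else lam j) * g j)).
rewrite (big_cat_nat (n := k)) //=; last exact: ltnW.
rewrite (big_ltn (m := k)) // gk mulr0 add0r.
have -> : \sum_(0 <= j < k) (if (j < k)%N then lam j / pi N else lam j) * g j =
    - q 0%N / pi N.
  under eq_big_nat => j /andP[_ jk].
    rewrite jk mulrAC tele ?(ltn_trans jk) //.
    over.
  rewrite -mulr_suml telescope_sumr // qk mul0r sub0r /pi big_ord0 divr1.
  by [].
under eq_big_nat => j /andP[kj jN].
  rewrite ltnNge (ltnW kj) /= tele //.
  over.
by rewrite telescope_sumr // qk1 mul0r subr0 qN mulNr addNr.
Qed.

(** A minor of [X - T k] is affine along each [C j], because its quadratic part is the minor of the
    rank-one matrix [C j]. It vanishes on the line through [T k] in the direction [C k], which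
    contains the partial sums before and after [C k]. So [cyclic_weights] applies, with weights that
    depend on [k] but not on the minor. *)
Lemma TN_minor2_sum (R : realType) (m n N : nat) (T : 'I_N -> 'M[R]_(m, n))
    (k : 'I_N) : TN_configuration T ->
  exists2 w : 'I_N -> R, forall j, 0 < w j &
    forall i1 i2 j1 j2, \sum_j w j * minor2 i1 i2 j1 j2 (T j - T k) = 0.
Proof.
case=> _ _ _ [P [C [kappa [kappa_gt1 TE rkC sumC]]]].
case: N T k C kappa kappa_gt1 TE rkC sumC => [|N] T k C kappa kappa_gt1 TE rkC sumC.
  by case: k.
(* [t j] is the weight of [T j] when the next partial sum is written as a point of the segment from
   the current one to [T j]; [inord] keeps it in the unit interval for every natural [j]. *)
pose t j := (kappa (inord j))^-1.
have t01 j : 0 < t j < 1.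
  by rewrite invr_gt0 invf_lt1 ?kappa_gt1 ?(lt_trans ltr01).
have [w w_gt0 wP] := cyclic_weights t01 (ltn_ord k).
exists (fun j => w j) => // i1 i2 j1 j2.
pose f X := minor2 i1 i2 j1 j2 (X - T k).
pose Q j := P + \sum_(l < N.+1 | (l < j)%N) C l.
have QS (j : 'I_N.+1) : Q j.+1 = Q j + C j.
  rewrite /Q -addrA; congr (_ + _).
  rewrite (bigD1 j) //= addrC; congr (_ + _).
  by apply: eq_bigl => l; rewrite ltnS [in RHS]ltn_neqAle andbC.
have TQ (j : 'I_N.+1) : T j = Q j + kappa j *: C j by rewrite TE.
have C0 j : minor2 i1 i2 j1 j2 (C j) = 0 by apply: minor2_rank1; rewrite rkC.
have fk (s : R) X : X = T k + s *: C k -> f X = 0.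
  move=> ->; rewrite /f addrC addKr; have := C0 k; rewrite /minor2 !mxE => h.
  have -> : forall a b c d : R,
      s * a * (s * b) - s * c * (s * d) = s ^+ 2 * (a * b - c * d) by move=> *; ring.
  by rewrite h mulr0.
have := wP (fun j => f (Q j)) (fun j => f (T (inord j))).
under eq_bigr do rewrite inord_val.
apply.
- move=> j jN; have {1 2}-> : j = Ordinal jN by [].
  have <- : Ordinal jN = inord j by apply: val_inj; rewrite /= inordK.
  have -> : t j = (kappa (Ordinal jN))^-1.
    by congr (kappa _)^-1; apply: val_inj; rewrite /= inordK.
  set i := Ordinal jN; have -> : j = i by [].
  rewrite QS TQ /f; have := C0 i; rewrite /minor2 !mxE.
  have := kappa_gt1 i; set s := kappa i => s1.
  have s0 : s != 0 by rewrite gt_eqF // (lt_trans ltr01).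
  move: (C i i1 j1) (C i i2 j2) (C i i1 j2) (C i i2 j1) => a b c d /eqP.
  rewrite subr_eq0 => /eqP cd.
  by field: cd.
- congr (f (P + _)); rewrite [RHS]big_pred0 // -[RHS]sumC.
  by apply: eq_bigl => l; rewrite ltn_ord.
- by apply: (fk (- kappa k)); rewrite TQ scaleNr addrK.
- apply: (fk (1 - kappa k)); rewrite QS TQ scalerBl scale1r addrACA subrr addr0.
  by rewrite addrC.
- by rewrite inord_val; apply: (fk 0); rewrite scale0r addr0.
Qed.

(** * Strictly convex functions and their antiderivatives *)

Section Antiderivatives.
Variable R : realType.
Implicit Types (a F G g : R -> R) (x y z m : R).

(** The mean value theorem for [G - F] stands in for integration: pointwise comparison of [f] and
    [g] becomes comparison of increments. *)
Lemma antiderivative_MVT F G f g x y :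
    antiderivative F f -> antiderivative G g -> x < y ->
  exists2 t, x < t < y & (G y - G x) - (F y - F x) = (g t - f t) * (y - x).
Proof.
move=> hF hG xy.
have dH t : is_derive t (1 : R) (G - F) (g t - f t).
  by have := hF t; have := hG t => ? ?; apply: is_deriveB.
have cH : {within `[x, y], continuous (G - F)}.
  by apply: derivable_within_continuous => t _; have [] := dH t.
have [t] := MVT xy (fun t _ => dH t) cH.
by rewrite in_itv /= => txy e; exists t => //; rewrite -e !fctE; ring.
Qed.

Lemma antiderivative_incr_lt F G f g x y :
    antiderivative F f -> antiderivative G g -> x < y ->
    (forall t, x < t < y -> f t < g t) -> F y - F x < G y - G x.
Proof.
move=> hF hG xy lt_fg; have [t txy e] := antiderivative_MVT hF hG xy.
by rewrite -subr_gt0 e mulr_gt0 ?subr_gt0 ?lt_fg.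
Qed.

Lemma antiderivative_incr_le F G f g x y :
    antiderivative F f -> antiderivative G g -> x <= y ->
    (forall t, x < t < y -> f t <= g t) -> F y - F x <= G y - G x.
Proof.
move=> hF hG; rewrite le_eqVlt => /predU1P[->|xy] le_fg; first by rewrite !subrr.
have [t txy e] := antiderivative_MVT hF hG xy.
by rewrite -subr_ge0 e mulr_ge0 ?subr_ge0 ?le_fg // ltW.
Qed.

Lemma antiderivative_affine x c m :
  antiderivative (fun t => c * (t - x) + m * ((t - x) ^+ 2 / 2))
    (fun t => c + m * (t - x)).
Proof.
move=> t; apply: is_derive_eq; rewrite /GRing.scale /=.
by field.
Qed.


(** * Chord slopes and supporting lines of a convex function *)

Lemma three_slopes a x y z : strictly_convex a -> x < y -> y < z ->
  (a y - a x) * (z - y) < (a z - a y) * (y - x).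
Proof.
move=> cvx xy yz; have xz := lt_trans xy yz.
have zx0 : 0 < z - x by rewrite subr_gt0.
pose t := (z - y) / (z - x).
have t0 : 0 < t by rewrite divr_gt0 ?subr_gt0.
have t1 : t < 1 by rewrite ltr_pdivrMr // mul1r ltrD2l ltrN2.
have tE : t * (z - x) = z - y by rewrite divfK ?gt_eqF.
have -> : z - y = t * (z - x) by [].
have -> : y - x = (1 - t) * (z - x) by rewrite mulrBl tE; ring.
have := cvx x z t (negbT (lt_eqF xz)) t0 t1.
have -> : t * x + (1 - t) * z = y.
  have -> : t * x + (1 - t) * z = z - t * (z - x) by ring.
  by rewrite tE; ring.
move=> h; rewrite -subr_gt0.
have -> : (a z - a y) * ((1 - t) * (z - x)) - (a y - a x) * (t * (z - x)) =
  (t * a x + (1 - t) * a z - a y) * (z - x) by ring.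
by rewrite mulr_gt0 // subr_gt0.
Qed.

Lemma three_slopes_le a x y z : strictly_convex a -> x <= y -> y <= z ->
  (a y - a x) * (z - y) <= (a z - a y) * (y - x).
Proof.
move=> cvx; rewrite le_eqVlt => /predU1P[->|xy]; first by rewrite !subrr mul0r mulr0.
rewrite le_eqVlt => /predU1P[->|yz]; first by rewrite !subrr mul0r mulr0.
by rewrite ltW // three_slopes.
Qed.

(** The slope is the supremum of the slopes of the chords ending at [y], which every chord starting
    at [y] bounds from above. It is positive because [a] increases. *)
Lemma supporting_line a y : strictly_increasing a -> strictly_convex a ->
  exists2 m, 0 < m & forall t, a y + m * (t - y) <= a t.
Proof.
move=> incr cvx.
pose slopes : set R := [set (a y - a s) / (y - s) | s in [set s | s < y]].
have ub z : y < z -> ubound slopes ((a z - a y) / (z - y)).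
  move=> yz _ [s /= sy <-]; rewrite ler_pdivrMr ?subr_gt0 //.
  rewrite mulrAC ler_pdivlMr ?subr_gt0 //.
  by rewrite ltW // three_slopes.
have hub : has_ubound slopes.
  by exists ((a (y + 1) - a y) / (y + 1 - y)); apply: ub; rewrite ltrDl.
have ne : slopes !=set0.
  by exists ((a y - a (y - 1)) / (y - (y - 1))); exists (y - 1) => //=; rewrite gtrBl.
have sle s : s < y -> (a y - a s) / (y - s) <= sup slopes.
  by move=> sy; apply: ub_le_sup => //; exists s.
exists (sup slopes).
  apply: lt_le_trans (sle (y - 1) _); last by rewrite gtrBl.
  by rewrite divr_gt0 ?subr_gt0 ?incr ?gtrBl.
move=> t; case: (ltgtP t y) => [ty|yt|->].
- have := sle _ ty; rewrite ler_pdivrMr ?subr_gt0 //; lra.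
- have := ge_sup ne (ub _ yt); rewrite ler_pdivlMr ?subr_gt0 //; lra.
- by rewrite subrr mulr0 addr0.
Qed.

(** * Integral bounds for the antiderivative of an increasing convex function *)

Section Estimates.
Variables a F : R -> R.
Hypotheses (incr : strictly_increasing a) (cvx : strictly_convex a)
  (antiF : antiderivative F a).

Lemma incr_le x y : x <= y -> a x <= a y.
Proof. by rewrite le_eqVlt => /predU1P[->//|/incr/ltW]. Qed.

Lemma left_rectangle x y : x <= y -> a x * (y - x) <= F y - F x.
Proof.
move=> xy; have := antiderivative_incr_le (antiderivative_affine x (a x) 0) antiF xy.
rewrite !mul0r subrr mulr0 !addr0 subr0; apply => t /andP[xt _].
by rewrite mul0r addr0 incr_le // ltW.
Qed.

(** [a] lies strictly below its chord, and the chord integrates to the trapezoid. *)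
Lemma trapezoid_lt x y : x < y -> F y - F x < (a x + a y) / 2 * (y - x).
Proof.
move=> xy; have yx0 : 0 < y - x by rewrite subr_gt0.
pose m := (a y - a x) / (y - x).
have mE : m * (y - x) = a y - a x by rewrite divfK ?gt_eqF.
have -> : (a x + a y) / 2 * (y - x) =
    (a x * (y - x) + m * ((y - x) ^+ 2 / 2)) - (a x * (x - x) + m * ((x - x) ^+ 2 / 2)).
  have -> : m * ((y - x) ^+ 2 / 2) = m * (y - x) * (y - x) / 2 by ring.
  by rewrite mE; field.
apply: antiderivative_incr_lt antiF (antiderivative_affine x (a x) m) xy _.
move=> t /andP[xt ty]; rewrite -(ltr_pM2r yx0) mulrDl mulrAC mE.
have := three_slopes cvx xt ty; lra.
Qed.

Lemma trapezoid_le x y : x <= y -> F y - F x <= (a x + a y) / 2 * (y - x).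
Proof.
rewrite le_eqVlt => /predU1P[->|/trapezoid_lt/ltW//].
by rewrite !subrr mulr0.
Qed.

Section Support.
Variables (z m : R).
Hypotheses (m_gt0 : 0 < m) (supp : forall t, a z + m * (t - z) <= a t).

Lemma support_right y : z <= y -> m * (y - z) ^+ 2 <= 2 * (F y - F z - a z * (y - z)).
Proof.
move=> zy.
have := antiderivative_incr_le (antiderivative_affine z (a z) m) antiF zy.
rewrite subrr => /(_ (fun t _ => supp t)); lra.
Qed.

(* The supporting line at [z] meets the level [a x] at [s], and [a] lies above both
   lines: this bounds the area between [a] and the level [a x] by a triangle. *)
Lemma support_left x : x <= z ->
  (a z - a x) ^+ 2 <= 2 * m * (F z - F x - a x * (z - x)).
Proof.
move=> xz; pose s := z - (a z - a x) / m.
have sE : m * (z - s) = a z - a x.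
  by rewrite /s opprB addrCA subrr addr0 mulrC divfK ?gt_eqF.
have xs : x <= s.
  rewrite -subr_ge0 -(pmulr_rge0 _ m_gt0); have := supp x; lra.
have sz : s <= z.
  rewrite -subr_ge0 -(pmulr_rge0 _ m_gt0) sE subr_ge0; exact: incr_le.
have h1 : a x * (s - x) <= F s - F x by exact: left_rectangle.
have h2 := antiderivative_incr_le (antiderivative_affine z (a z) m) antiF sz.
have {h2} := h2 (fun t _ => supp t); rewrite subrr => h2.
have : m * ((a z - a x) * (z - s) - m * ((z - s) ^+ 2 / 2)) <=
    m * (F z - F x - a x * (z - x)).
  rewrite ler_pM2l //; lra.
have -> : m * ((a z - a x) * (z - s) - m * ((z - s) ^+ 2 / 2)) =
  (m * (z - s)) * (a z - a x) - (m * (z - s)) ^+ 2 / 2 by field.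
rewrite sE; lra.
Qed.

End Support.
End Estimates.

End Antiderivatives.

(** * Four points in Lorentzian position *)

Section Inequalities.
Variable R : rcfType.
Implicit Types (a b c d e h k m p q r s t x y : R).

Lemma le_of_sqr x y : 0 <= y -> x ^+ 2 <= y ^+ 2 -> x <= y.
Proof.
move=> y0; apply: contraTle => yx.
by rewrite -ltNge ltr_sqr ?nnegrE ?(ltW (le_lt_trans y0 yx)).
Qed.

Lemma lt_of_sqr x y : 0 <= y -> x ^+ 2 < y ^+ 2 -> x < y.
Proof.
move=> y0; apply: contraTlt => yx.
by rewrite -leNgt ler_sqr ?nnegrE ?(le_trans y0).
Qed.

(* Reverse triangle inequality for timelike vectors of the Lorentzian form
   [a * c - r ^+ 2]. *)
Lemma timelike_add a b c d r s :
    0 <= a -> 0 <= b -> 0 <= c -> 0 <= d ->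
    r ^+ 2 < a * c -> s ^+ 2 <= b * d ->
  (r + s) ^+ 2 < (a + b) * (c + d).
Proof.
move=> a0 b0 c0 d0 rac sbd.
suff : 2 * (r * s) <= a * d + b * c by lra.
apply: le_of_sqr; first by rewrite addr_ge0 ?mulr_ge0.
have h : r ^+ 2 * s ^+ 2 <= (a * c) * (b * d) by rewrite ler_pM ?sqr_ge0 // ltW.
have := sqr_ge0 (a * d - b * c); nra.
Qed.

(** For each claim, [a2] (respectively [a3]) times the positive sum is split off the equation; under
    the contrary sign the monotone [aj] leave only nonnegative terms. If that coefficient is 0,
    strictness comes from the term with [e4]. *)
Lemma row_signs_first x2 x3 x4 a2 a3 a4 e2 e3 e4 :
    0 < x2 -> 0 < x3 -> 0 < x4 -> 0 <= a2 -> a2 <= a3 -> a3 <= a4 -> 0 < a4 ->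
    0 < x2 * e2 + x3 * e3 + x4 * e4 ->
    x2 * (a2 * e2) + x3 * (a3 * e3) + x4 * (a4 * e4) = 0 -> 0 < e4 ->
  e3 < 0 /\ 0 < e2.
Proof.
move=> x2p x3p x4p a20 a23 a34 a40 S1 S2 e40.
have e3n : e3 < 0.
  rewrite ltNge; apply/negP => e30.
  have : 0 = a2 * (x2 * e2 + x3 * e3 + x4 * e4) + (a3 - a2) * (x3 * e3)
      + (a4 - a2) * (x4 * e4) by rewrite -S2; ring.
  have h3 : 0 <= (a3 - a2) * (x3 * e3) by rewrite !mulr_ge0 ?subr_ge0 // ltW.
  have [a2p|a2n] := ltrP 0 a2.
    have : 0 < a2 * (x2 * e2 + x3 * e3 + x4 * e4) by rewrite mulr_gt0.
    have : 0 <= (a4 - a2) * (x4 * e4).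
      by rewrite !mulr_ge0 ?subr_ge0 ?(le_trans a23) // ltW.
    lra.
  have a2E : a2 = 0 by lra.
  have : 0 < (a4 - 0) * (x4 * e4) by rewrite subr0 !mulr_gt0.
  move: h3; rewrite a2E; lra.
split=> //; rewrite ltNge; apply/negP => e2n.
have : 0 = a3 * (x2 * e2 + x3 * e3 + x4 * e4) + (a3 - a2) * (x2 * - e2)
    + (a4 - a3) * (x4 * e4) by rewrite -S2; ring.
have : 0 <= (a3 - a2) * (x2 * - e2).
  by rewrite !mulr_ge0 ?subr_ge0 ?oppr_ge0 // ltW.
have h4 : 0 <= (a4 - a3) * (x4 * e4) by rewrite !mulr_ge0 ?subr_ge0 // ltW.
have [a3p|a3n] := ltrP 0 a3.
  have : 0 < a3 * (x2 * e2 + x3 * e3 + x4 * e4) by rewrite mulr_gt0.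
  lra.
have a30 : a3 = 0 by lra.
rewrite a30; have : 0 < (a4 - 0) * (x4 * e4) by rewrite subr0 !mulr_gt0.
lra.
Qed.

Lemma row_signs_last y1 y2 y3 a1 a2 a3 e1 e2 e3 :
    0 < y1 -> 0 < y2 -> 0 < y3 -> 0 <= a3 -> a3 <= a2 -> a2 <= a1 -> 0 < a1 ->
    y1 * e1 + y2 * e2 + y3 * e3 < 0 ->
    y1 * (a1 * e1) + y2 * (a2 * e2) + y3 * (a3 * e3) = 0 -> e1 < 0 ->
  0 < e2 /\ e3 < 0.
Proof.
move=> y1p y2p y3p a30 a32 a21 a10 S1 S2 e1n.
have e2p : 0 < e2.
  rewrite ltNge; apply/negP => e20.
  have : 0 = a3 * (y1 * e1 + y2 * e2 + y3 * e3) - (a2 - a3) * (y2 * - e2)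
      - (a1 - a3) * (y1 * - e1) by rewrite -S2; ring.
  have h3 : 0 <= (a2 - a3) * (y2 * - e2).
    by rewrite !mulr_ge0 ?subr_ge0 ?oppr_ge0 // ltW.
  have h1 : 0 <= (a1 - a3) * (y1 * - e1).
    by rewrite !mulr_ge0 ?subr_ge0 ?oppr_ge0 ?(le_trans a32) // ltW.
  have [a3p|a3n] := ltrP 0 a3.
    have : a3 * (y1 * e1 + y2 * e2 + y3 * e3) < 0 by rewrite pmulr_rlt0.
    lra.
  have a3E : a3 = 0 by lra.
  have : 0 < (a1 - 0) * (y1 * - e1) by rewrite subr0 !mulr_gt0 ?oppr_gt0.
  move: h3; rewrite a3E; lra.
split=> //; rewrite ltNge; apply/negP => e3p.
have : 0 = a1 * (y1 * e1 + y2 * e2 + y3 * e3) - (a1 - a2) * (y2 * e2)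
    - (a1 - a3) * (y3 * e3) by rewrite -S2; ring.
have : 0 <= (a1 - a2) * (y2 * e2) by rewrite !mulr_ge0 ?subr_ge0 // ltW.
have : 0 <= (a1 - a3) * (y3 * e3).
  by rewrite !mulr_ge0 ?subr_ge0 ?(le_trans a32) // ltW.
have : a1 * (y1 * e1 + y2 * e2 + y3 * e3) < 0 by rewrite pmulr_rlt0.
lra.
Qed.

(* The points are numbered by increasing [v], with
   [pj = u4 - uj] up to a common sign, [aj = a v4 - a vj], [tj = v4 - vj],
   [Xj] and [Yj] are the gaps from the point 4 to the point [j] and back. *)
Lemma first_last_spacelike p1 p2 p3 a1 a2 a3 t1 t2 t3
    X1 X2 X3 Y1 Y2 Y3 y1 y2 y3 m :
    0 < y1 -> 0 < y2 -> 0 < y3 ->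
    0 <= a3 -> a3 <= a2 -> a2 <= a1 -> 0 <= t3 -> t3 <= t2 -> t2 <= t1 ->
    X1 + Y1 = 2 * (p1 ^+ 2 - a1 * t1) -> X2 + Y2 = 2 * (p2 ^+ 2 - a2 * t2) ->
    X3 + Y3 = 2 * (p3 ^+ 2 - a3 * t3) -> X1 < Y1 -> X2 <= Y2 -> X3 <= Y3 ->
    y1 * (X1 + Y1) + y2 * (X2 + Y2) + y3 * (X3 + Y3) = 0 ->
    y1 * (a1 * X1) + y2 * (a2 * X2) + y3 * (a3 * X3) = 0 ->
    y1 * (p1 * Y1) + y2 * (p2 * Y2) + y3 * (p3 * Y3) = 0 ->
    a1 * t2 <= a2 * t1 ->
    0 < m -> m * t3 <= a3 -> m * (t2 - t3) <= a2 - a3 ->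
    (a1 - a2) ^+ 2 <= m * (p1 - p2) ^+ 2 ->
    p2 ^+ 2 - Y2 <= (a2 - a3) * (t2 - t3) + (2 * a2 - a3) * t3 ->
    a1 * t1 <= p1 ^+ 2 -> (p1 - p3) ^+ 2 < (a1 - a3) * (t1 - t3) ->
  0 < p1 -> False.
Proof.
move=> y1p y2p y3p a30 a32 a21 t30 t32 t21 D1 D2 D3 XY1 XY2 XY3 R1 R2 R3.
move=> conc m0 mt3 mt23 e12 c2 d1 d13 p1p.
have a20 := le_trans a30 a32; have a31 := le_trans a32 a21; have t31 := le_trans t32 t21.
have a13 : 0 <= a1 - a3 by rewrite subr_ge0.
have t13 : 0 <= t1 - t3 by rewrite subr_ge0.
(* If 3, 4 were timelike or null separated, the reverse triangle inequality through 3 would make 1,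
   4 timelike. *)
have d3 : a3 * t3 < p3 ^+ 2.
  rewrite ltNge; apply/negP => le3.
  have := timelike_add a13 a30 t13 t30 d13 le3.
  by rewrite !subrK ltNge d1.
have d2 : p2 ^+ 2 < a2 * t2.
  have : 0 < y3 * (X3 + Y3) by rewrite D3 !mulr_gt0 ?subr_gt0.
  have : 0 <= y1 * (X1 + Y1) by rewrite D1 !mulr_ge0 ?subr_ge0 // ltW.
  move=> h1 h3; have : y2 * (X2 + Y2) < 0 by clear -R1 h1 h3; lra.
  by rewrite D2 pmulr_rlt0 // pmulr_rlt0 // subr_lt0.
have a10 : 0 < a1.
  rewrite lt_neqAle (le_trans a30 a31) andbT; apply/eqP => a1E.
  have a2E : a2 = 0 by clear -a20 a21 a1E; lra.
  by move: d2; rewrite a2E mul0r ltNge sqr_ge0.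
have p13 : 0 < p3.
  rewrite -(ltrD2l p1) addr0 -ltrBlDr; apply: lt_of_sqr; first exact: ltW.
  apply: (lt_le_trans d13); apply: (le_trans _ d1).
  by apply: ler_pM => //; rewrite gerBl.
(* The three equations combine to a sum that is positive as soon as
   [p = al * a - 2 * s] is a line of the plane of [(a, p)] which lies below the
   points 1 and 3 and above the point 2. *)
have line al s : 0 <= al -> al * a1 - 2 * s <= p1 -> al * a3 - 2 * s <= p3 ->
    p2 <= al * a2 - 2 * s -> 0 <= p2 + al * a2 -> False.
  move=> al0 l1 l3 l2 l2'.
  have : y1 * ((p1 - al * a1 + 2 * s) * (X1 + Y1) + (p1 + al * a1) * (Y1 - X1))
       + y2 * ((p2 - al * a2 + 2 * s) * (X2 + Y2) + (p2 + al * a2) * (Y2 - X2))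
       + y3 * ((p3 - al * a3 + 2 * s) * (X3 + Y3) + (p3 + al * a3) * (Y3 - X3))
     = 2 * (y1 * (p1 * Y1) + y2 * (p2 * Y2) + y3 * (p3 * Y3))
       - 2 * al * (y1 * (a1 * X1) + y2 * (a2 * X2) + y3 * (a3 * X3))
       + 2 * s * (y1 * (X1 + Y1) + y2 * (X2 + Y2) + y3 * (X3 + Y3)) by ring.
  rewrite R1 R2 R3 !mulr0 subrr addr0.
  have h1 : 0 < y1 * ((p1 - al * a1 + 2 * s) * (X1 + Y1) + (p1 + al * a1) * (Y1 - X1)).
    rewrite mulr_gt0 // ltr_wpDl //.
      by rewrite mulr_ge0 ?D1 ?mulr_ge0 ?subr_ge0 //; clear -l1; lra.
    by rewrite mulr_gt0 ?subr_gt0 // ltr_wpDr // mulr_ge0 // ltW.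
  have h2 : 0 <= y2 * ((p2 - al * a2 + 2 * s) * (X2 + Y2) + (p2 + al * a2) * (Y2 - X2)).
    apply: mulr_ge0; first exact: ltW.
    apply: addr_ge0; last by rewrite mulr_ge0 ?subr_ge0.
    rewrite D2; apply: mulr_le0; [clear -l2|clear -d2]; lra.
  have h3 : 0 <= y3 * ((p3 - al * a3 + 2 * s) * (X3 + Y3) + (p3 + al * a3) * (Y3 - X3)).
    apply: mulr_ge0; first exact: ltW.
    apply: addr_ge0.
      by rewrite mulr_ge0 ?D3 ?mulr_ge0 ?subr_ge0 ?(ltW d3) //; clear -l3; lra.
    by rewrite mulr_ge0 ?subr_ge0 // addr_ge0 ?mulr_ge0 // ltW.
  clear -h1 h2 h3; lra.
have Y1p : 0 < Y1 by clear -D1 d1 XY1; lra.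
have Y3p : 0 < Y3 by clear -D3 d3 XY3; lra.
(* If [p2 * Y2 >= 0], the [p]-equation alone is contradictory. For [Y2 >= 0 > p2] the line of slope
   [p1 / a1] through the origin meets point 1; if point 3 lies below it, it is lowered until it
   meets point 3. *)
have [Y2p|Y2n] := lerP 0 Y2.
  have [p20|p2n] := lerP 0 p2.
    have h1 : 0 < y1 * (p1 * Y1) by rewrite !mulr_gt0.
    have h2 : 0 <= y2 * (p2 * Y2) by rewrite !mulr_ge0 // ltW.
    have h3 : 0 < y3 * (p3 * Y3) by rewrite !mulr_gt0.
    clear -R3 h1 h2 h3; lra.
  have al0 : 0 <= p1 / a1 by rewrite divr_ge0 // ltW.
  have alE : p1 / a1 * a1 = p1 by rewrite divfK // gt_eqF.
  have p2al : 0 <= p2 + p1 / a1 * a2.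
    rewrite -(pmulr_lge0 _ a10) mulrDl mulrAC alE -(opprK (p2 * a1)) addrC subr_ge0.
    apply: le_of_sqr; first by rewrite mulr_ge0 // ltW.
    have : p2 ^+ 2 * a1 ^+ 2 <= a2 * t2 * a1 ^+ 2 by rewrite ler_pM ?sqr_ge0 // ltW.
    have : (a1 * t2) * (a1 * a2) <= (a2 * t1) * (a1 * a2).
      by rewrite ler_wpM2r // mulr_ge0 // ltW.
    have : (a1 * t1) * a2 ^+ 2 <= p1 ^+ 2 * a2 ^+ 2 by rewrite ler_wpM2r ?sqr_ge0.
    clear; lra.
  have al32 : p1 / a1 * a3 <= p1 / a1 * a2 by rewrite ler_wpM2l.
  have al20 : 0 <= p1 / a1 * a2 by rewrite mulr_ge0.
  have [le3|gt3] := lerP (p1 / a1 * a3) p3.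
    by apply: (line (p1 / a1) 0) => //; clear -alE le3 p2n al20; lra.
  by apply: (line (p1 / a1) ((p1 / a1 * a3 - p3) / 2)) => //;
    clear -alE gt3 p2n p13 al20 al32; lra.
have [p20|p2p] := lerP p2 0.
  have h1 : 0 < y1 * (p1 * Y1) by rewrite !mulr_gt0.
  have h2 : 0 <= y2 * (p2 * Y2) by rewrite pmulr_rge0 // mulr_le0 // ltW.
  have h3 : 0 < y3 * (p3 * Y3) by rewrite !mulr_gt0.
  clear -R3 h1 h2 h3; lra.
(* For [p2 > 0 > Y2] the line goes through point 2 with slope [1 / mu], where [mu] comes from the
   supporting line at [v2]; [l1] and [l3] place the points 1 and 3 above it. *)
pose mu := Num.sqrt m.
have mu0 : 0 < mu by rewrite sqrtr_gt0.
have muE : mu ^+ 2 = m by rewrite sqr_sqrtr // ltW.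
have p12 : p2 <= p1.
  apply: le_of_sqr; first exact: ltW.
  rewrite (le_trans (ltW d2)) // (le_trans _ d1) // ler_pM //.
  exact: le_trans t30 t32.
have l1 : a1 - a2 <= mu * (p1 - p2).
  by apply: le_of_sqr; rewrite ?mulr_ge0 ?subr_ge0 ?(ltW mu0) // exprMn muE.
have mut3 : mu * t3 <= p3.
  apply: le_of_sqr; first exact: ltW.
  rewrite exprMn muE; have : m * t3 * t3 <= a3 * t3 by rewrite ler_wpM2r.
  clear -d3; lra.
have l3 : mu * (p2 - p3) <= a2 - a3.
  rewrite mulrBr lerBlDl; apply: le_of_sqr.
    by rewrite addr_ge0 ?subr_ge0 // mulr_ge0 // ltW.
  have : m * p2 ^+ 2 <= m * ((a2 - a3) * (t2 - t3) + (2 * a2 - a3) * t3).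
    by rewrite ler_pM2l //; clear -c2 Y2n; lra.
  have : m * (t2 - t3) * (a2 - a3) <= (a2 - a3) * (a2 - a3) by rewrite ler_wpM2r ?subr_ge0.
  have : m * (a3 * t3) <= m * p3 ^+ 2 by rewrite ler_pM2l // ltW.
  have : (mu * t3) * (mu * (a2 - a3)) <= p3 * (mu * (a2 - a3)).
    by rewrite ler_wpM2r // mulr_ge0 ?subr_ge0 // ltW.
  have -> : mu * t3 * (mu * (a2 - a3)) = m * (t3 * (a2 - a3)) by rewrite -muE; ring.
  have -> : (mu * p2) ^+ 2 = m * p2 ^+ 2 by rewrite -muE; ring.
  have -> : (mu * p3 + (a2 - a3)) ^+ 2 =
      m * p3 ^+ 2 + 2 * (p3 * (mu * (a2 - a3))) + (a2 - a3) ^+ 2.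
    by rewrite -muE; ring.
  clear; lra.
have al2 : 0 <= mu^-1 * a2 by rewrite mulr_ge0 ?invr_ge0 // ltW.
apply: (line mu^-1 ((mu^-1 * a2 - p2) / 2)).
- by rewrite invr_ge0 ltW.
- have : mu^-1 * (a1 - a2) <= p1 - p2 by rewrite ler_pdivrMl.
  clear; lra.
- have : p2 - p3 <= mu^-1 * (a2 - a3) by rewrite ler_pdivlMl.
  clear; lra.
- clear; lra.
- clear -p2p al2; lra.
Qed.

(** In [first_last_timelike_scaled] this contradicts the key inequality when [Y < 0], where
    [p1 > 0]. The two brackets differ by at least [2 * (h - d)], which absorbs the excess of [q]
    over [(1 + d) * p]. *)
Lemma same_side_bound d e h k p q :
    0 <= d -> 0 <= h -> d <= e -> e ^+ 2 <= d * h -> 0 <= k ->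
    1 <= p -> q <= p + e -> e - 1 <= q ->
    q ^+ 2 <= 1 - k + e ^+ 2 + 2 * d ->
  q * (1 - k + e ^+ 2 + 2 * d - q ^+ 2) <=
    (1 + d) * p * (1 + k + 2 * d * h - e ^+ 2 + 2 * h - q ^+ 2).
Proof.
move=> d0 h0 de edh k0 p1 qp eq cq.
have e0 := le_trans d0 de.
pose Y := 1 - k + e ^+ 2 + 2 * d - q ^+ 2.
have Y0 : 0 <= Y by rewrite subr_ge0.
have dh : d <= h.
  rewrite leNgt; apply/negP => hd.
  have : d * h < d * d by rewrite ltr_pM2l // (le_lt_trans h0).
  have : d ^+ 2 <= e ^+ 2 by rewrite ler_sqr ?nnegrE.
  lra.
have -> : 1 + k + 2 * d * h - e ^+ 2 + 2 * h - q ^+ 2 =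
    Y + (2 * k + 2 * (d * h - e ^+ 2) + 2 * (h - d)) by rewrite /Y; ring.
rewrite -/Y -subr_ge0.
have -> : (1 + d) * p * (Y + (2 * k + 2 * (d * h - e ^+ 2) + 2 * (h - d))) - q * Y =
  (1 + d) * p * (2 * k + 2 * (d * h - e ^+ 2) + 2 * (h - d)) - (q - (1 + d) * p) * Y by ring.
rewrite subr_ge0.
have rhs : 2 * ((1 + d) * (h - d)) <=
    (1 + d) * p * (2 * k + 2 * (d * h - e ^+ 2) + 2 * (h - d)).
  have -> : 2 * ((1 + d) * (h - d)) = (1 + d) * 1 * (2 * (h - d)) by ring.
  by rewrite ler_pM ?mulr_ge0 ?ler_wpM2l //; lra.
have hd0 : 0 <= d * (h - d) by rewrite mulr_ge0 ?subr_ge0.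
(* Beyond [(1 + d) * p] the excess of [q] is at most [e - d], and [Y] is at most [2 * (e + d)]; the
   product is at most [2 * d * (h - d)], which [rhs] dominates. *)
have [qle|qgt] := lerP q ((1 + d) * p).
  apply: (@le_trans _ _ 0); first by rewrite mulr_le0_ge0 // subr_le0.
  by apply: le_trans rhs; lra.
apply: le_trans rhs.
have dp : d <= d * p by rewrite ler_peMr.
have Yle : Y <= 2 * (e + d).
  suff : 1 + e ^+ 2 <= 2 * e + q ^+ 2 by rewrite /Y; lra.
  have q1 : 1 <= q by lra.
  have [e2|e2] := lerP e 2.
    have : 1 <= q ^+ 2 by rewrite exprn_ege1.
    have : e * e <= 2 * e by rewrite ler_wpM2r.
    lra.
  have : (e - 1) ^+ 2 <= q ^+ 2 by rewrite ler_sqr ?nnegrE //; lra.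
  lra.
apply: (@le_trans _ _ ((e - d) * (2 * (e + d)))).
  by apply: ler_pM => //; lra.
lra.
Qed.

(** The counterpart of [same_side_bound] for [Y > 0], where [p1 < 0] and [q] stands for [- p1]. The
    bound [q <= 1 + e] limits how far [q ^+ 2] exceeds the first bracket, and the distance between
    the brackets outweighs this. *)
Lemma opposite_side_bound d e h k p q :
    0 <= d -> 0 <= h -> d <= e -> e ^+ 2 <= d * h -> 0 <= k -> 1 <= p ->
    0 <= q -> q <= 1 + e -> d ^+ 2 <= e ^+ 2 * (1 - k) -> k <= 1 ->
    1 - k + e ^+ 2 + 2 * d <= q ^+ 2 ->
    q ^+ 2 <= 1 + k + 2 * d * h - e ^+ 2 + 2 * h ->
  q * (q ^+ 2 - (1 - k + e ^+ 2 + 2 * d)) <=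
    (1 + d) * p * (1 + k + 2 * d * h - e ^+ 2 + 2 * h - q ^+ 2).
Proof.
move=> d0 h0 de edh k0 p1 q0 q1e dek k1 cq qb.
have e0 := le_trans d0 de.
set c := 1 - k + e ^+ 2 + 2 * d in cq *.
set b := 1 + k + 2 * d * h - e ^+ 2 + 2 * h in qb *.
apply: (@le_trans _ _ ((1 + d) * 1 * (b - q ^+ 2))); last first.
  rewrite ler_wpM2r ?subr_ge0 // ler_wpM2l //; lra.
rewrite -subr_ge0.
have -> : (1 + d) * 1 * (b - q ^+ 2) - q * (q ^+ 2 - c) =
  (1 + d) * (b - c) - (q + 1 + d) * (q ^+ 2 - c) by ring.
rewrite subr_ge0.
have qc : q ^+ 2 - c <= 2 * (e - d) + k.
  have : q ^+ 2 <= (1 + e) ^+ 2 by rewrite ler_sqr ?nnegrE //; lra.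
  rewrite /c; lra.
apply: (@le_trans _ _ ((2 + e + d) * (2 * (e - d) + k))).
  by rewrite ler_pM ?subr_ge0 //; lra.
have -> : b - c = 2 * k + 2 * h - 2 * d + 2 * (d * h - e ^+ 2) by rewrite /b /c; ring.
have [d_gt0|d_le0] := ltrP 0 d; last first.
  have dE : d = 0 by lra.
  have eE : e = 0.
    apply/eqP; rewrite -sqrf_eq0; have := sqr_ge0 e; move: edh; rewrite dE mul0r => h1 h2.
    by rewrite eq_le h1 h2.
  rewrite dE eE; lra.
(* This rests on [(1 - k) * (2 + k) ^+ 2 = 4 - k ^+ 2 * (3 + k)]. *)
have ek : d * (2 + k) <= 2 * e.
  apply: le_of_sqr; first by rewrite mulr_ge0.
  have : d ^+ 2 * (2 + k) ^+ 2 <= e ^+ 2 * (1 - k) * (2 + k) ^+ 2.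
    by rewrite ler_wpM2r ?sqr_ge0.
  have : 0 <= e ^+ 2 * (k ^+ 2 * (3 + k)).
    by rewrite !mulr_ge0 ?sqr_ge0 //; lra.
  lra.
rewrite -(ler_pM2l d_gt0).
have : 0 <= (e - d) * (2 * e - d * (2 + k)) by rewrite mulr_ge0 ?subr_ge0.
have : 0 <= (1 + d) * ((1 + d) * (d * h - e ^+ 2)) by rewrite !mulr_ge0 ?subr_ge0 //; lra.
lra.
Qed.

(** [p] is at most the geometric mean [s] of [x] and [y], and [q] at most [1 + e - s], since
    [(1 - x) * (1 - y) <= (1 - s) ^+ 2] and the slope bounds give [d * (1 - x) <= e * (1 - s)]. *)
Lemma timelike_step d e m p q x y :
    0 <= d -> 0 <= e -> d ^+ 2 <= m * e ^+ 2 -> 0 < m ->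
    m * (1 - x) <= 1 - y -> 0 <= x -> x <= 1 -> 0 <= y -> y <= 1 ->
    p ^+ 2 <= x * y -> q ^+ 2 <= e ^+ 2 + (1 - x) * (1 - y) + 2 * d * (1 - x) ->
  q + p <= 1 + e.
Proof.
move=> d0 e0 dme m0 mxy x0 x1 y0 y1 pxy qle.
have x1' : 0 <= 1 - x by rewrite subr_ge0.
have y1' : 0 <= 1 - y by rewrite subr_ge0.
pose s := Num.sqrt (x * y).
have s0 : 0 <= s by rewrite sqrtr_ge0.
have sE : s ^+ 2 = x * y by rewrite sqr_sqrtr // mulr_ge0.
have s1 : s <= 1.
  by apply: le_of_sqr => //; rewrite sE expr1n mulr_ile1.
have ps : p <= s by apply: le_of_sqr; rewrite ?sE.
suff : q <= 1 + e - s by clear -ps; lra.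
have xys : (1 - x) * (1 - y) <= (1 - s) ^+ 2.
  suff : 2 * s <= x + y by clear -sE; lra.
  apply: le_of_sqr; first exact: addr_ge0.
  have := sqr_ge0 (x - y); clear -sE; lra.
have ds : d * (1 - x) <= e * (1 - s).
  apply: le_of_sqr; first by rewrite mulr_ge0 ?subr_ge0.
  rewrite !exprMn; apply: (@le_trans _ _ (e ^+ 2 * ((1 - x) * (1 - y)))); last first.
    by rewrite ler_wpM2l ?sqr_ge0.
  apply: (@le_trans _ _ (m * e ^+ 2 * (1 - x) ^+ 2)); first by rewrite ler_wpM2r ?sqr_ge0.
  have : e ^+ 2 * ((1 - x) * (m * (1 - x))) <= e ^+ 2 * ((1 - x) * (1 - y)).
    by rewrite ler_wpM2l ?sqr_ge0 // ler_wpM2l.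
  clear; lra.
apply: le_of_sqr; first by clear -s1 e0; lra.
apply: (le_trans qle); clear -xys ds; lra.
Qed.

(* The case [a2 = t2 = 1] of [first_last_timelike] below, with [d = a v2 - a v1],
   [h = v2 - v1], [x = t3], [y = a3], [e ^+ 2 = b21], [1 - k = b42], [r = b31]. *)
Lemma first_last_timelike_scaled d e h k m p1 p2 p3 r x y :
    0 <= d -> 0 <= h -> 0 <= e -> e ^+ 2 <= d * h -> 0 <= k ->
    0 < m -> d ^+ 2 <= m * e ^+ 2 -> m <= 1 - k -> m * (1 - x) <= 1 - y ->
    0 <= x -> x <= 1 -> 0 <= y -> y <= 1 ->
    e ^+ 2 <= r -> r <= e ^+ 2 + (1 - x) * (1 - y) + 2 * d * (1 - x) ->
    p3 ^+ 2 < x * y -> 0 < p2 -> 1 + k < p2 ^+ 2 ->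
    let X := p1 ^+ 2 - (1 + k + 2 * d * h - e ^+ 2 + 2 * h) in
    let Y := p1 ^+ 2 - (1 - k + e ^+ 2 + 2 * d) in
    X < 0 -> X < Y -> p1 * Y < (1 + d) * p2 * X ->
    (0 < Y -> (p1 - p3) ^+ 2 < r) ->
    (Y < 0 -> (p1 - p2) ^+ 2 <= e ^+ 2 -> r < (p1 - p3) ^+ 2) ->
  False.
Proof.
move=> d0 h0 e0 edh k0 m0 dme mk mxy x0 x1 y0 y1 er rle p3xy p20 kp2 X Y.
move=> X0 XY key Ypos Yneg.
have m1 : m <= 1 by clear -mk k0; lra.
have de : d <= e.
  by apply: le_of_sqr => //; apply: (le_trans dme); rewrite ler_piMl ?sqr_ge0.
have p21 : 1 < p2 by apply: lt_of_sqr; [exact: ltW | rewrite expr1n; clear -k0 kp2; lra].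
have d1p : 0 < (1 + d) * p2 by rewrite mulr_gt0 // ltr_wpDr.
have key0 : p1 * Y < 0 by apply: (lt_trans key); rewrite pmulr_rlt0.
have p3lt1 : p3 ^+ 2 < 1 ^+ 2 by apply: (lt_le_trans p3xy); rewrite expr1n mulr_ile1.
have p3l1 : p3 < 1 by apply: lt_of_sqr.
have p3g1 : - p3 < 1 by apply: lt_of_sqr; rewrite ?sqrrN.
(* [p1] and [Y] have opposite signs: [Y < 0] leads to [same_side_bound], [Y > 0] to
   [opposite_side_bound]. *)
have [Y0|Y0|Y0] := ltgtP Y 0; last by move: key0; rewrite Y0 mulr0 ltxx.
- have p10 : 0 < p1 by rewrite -(nmulr_llt0 _ Y0).
  have p12 : p2 < p1.
    have : (1 + d) * p2 < p1.
      rewrite -(ltr_nM2r Y0); apply: (lt_le_trans key).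
      by rewrite ler_pM2l // ltW.
    by apply: le_lt_trans; rewrite ler_peMl ?(ltW p20) // lerDl.
  (* Otherwise [p1 > p2 + e], which makes [Y] positive because [d <= e] and [1 + k < p2 ^+ 2]. *)
  have [p12e|p12e] := lerP ((p1 - p2) ^+ 2) (e ^+ 2); last first.
    have {}p12e : e < p1 - p2 by apply: lt_of_sqr => //; rewrite subr_ge0 ltW.
    have h1 : (p2 + e) ^+ 2 < p1 ^+ 2.
      by rewrite ltr_sqr ?nnegrE ?addr_ge0 ?(ltW p20) ?(ltW p10) //; clear -p12e; lra.
    have h2 : 1 * e <= p2 * e by rewrite ler_wpM2r // ltW.
    move: Y0; rewrite /Y; clear -de k0 kp2 h1 h2; lra.
  have p13 : e < p1 - p3.
    apply: lt_of_sqr; first by clear -p12 p21 p3l1; lra.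
    exact: (le_lt_trans er (Yneg Y0 p12e)).
  have q1 : p1 <= p2 + e.
    by rewrite -lerBlDl; apply: le_of_sqr.
  have q2 : e - 1 <= p1 by clear -p13 p3g1; lra.
  have q3 : p1 ^+ 2 <= 1 - k + e ^+ 2 + 2 * d by rewrite -subr_le0 ltW.
  have := same_side_bound d0 h0 de edh k0 (ltW p21) q1 q2 q3.
  move: key; rewrite /X /Y; clear; lra.
have p10 : p1 < 0 by rewrite -(pmulr_llt0 _ Y0).
have q1e : - p1 <= 1 + e.
  have := timelike_step (p := - p3) (q := p3 - p1) d0 e0 dme m0 mxy x0 x1 y0 y1.
  rewrite sqrrN => /(_ (ltW p3xy)).
  have -> : (p3 - p1) ^+ 2 = (p1 - p3) ^+ 2 by ring.
  move=> /(_ (le_trans (ltW (Ypos Y0)) rle)); clear; lra.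
have dek : d ^+ 2 <= e ^+ 2 * (1 - k).
  by apply: (le_trans dme); rewrite mulrC ler_wpM2l ?sqr_ge0.
have q0 : 0 <= - p1 by rewrite oppr_ge0 ltW.
have k1 : k <= 1 by clear -m0 mk; lra.
have h1 : 1 - k + e ^+ 2 + 2 * d <= (- p1) ^+ 2 
  by rewrite sqrrN -subr_ge0 ltW.
have h2 : (- p1) ^+ 2 <= 1 + k + 2 * d * h - e ^+ 2 + 2 * h.
  by rewrite sqrrN -subr_le0 ltW.
have := opposite_side_bound d0 h0 de edh k0 (ltW p21) q0 q1e dek k1 h1 h2.
move: key; rewrite sqrrN /X /Y; clear; lra.
Qed.

(* Here [bij] is twice the Bregman divergence of [F] from [vj] to [vi], and [m] is
   the slope of a supporting line of [a] at [v2]. *)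
Lemma first_last_timelike d h m p1 p2 p3 a2 a3 t2 t3 b21 b31 b42 :
    0 <= d -> 0 <= h -> 0 < a2 -> 0 < t2 -> 0 <= a3 -> a3 <= a2 ->
    0 <= t3 -> t3 <= t2 ->
    0 <= b21 -> b21 <= d * h -> b42 <= a2 * t2 ->
    0 < m -> d ^+ 2 <= m * b21 -> m * t2 ^+ 2 <= b42 ->
    m * (t2 - t3) <= a2 - a3 ->
    b21 <= b31 -> b31 <= b21 + (a2 - a3) * (t2 - t3) + 2 * d * (t2 - t3) ->
    p3 ^+ 2 < a3 * t3 -> 0 < p2 -> 2 * (a2 * t2) - b42 < p2 ^+ 2 ->
    let X := p1 ^+ 2 - (2 * (a2 * t2) - b42 + 2 * d * h - b21 + 2 * h * a2) in
    let Y := p1 ^+ 2 - (b42 + b21 + 2 * d * t2) in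
    X < 0 -> X < Y -> a2 * (p1 * Y) < p2 * ((a2 + d) * X) ->
    (0 < Y -> (p1 - p3) ^+ 2 < b31) ->
    (Y < 0 -> (p1 - p2) ^+ 2 <= b21 -> b31 < (p1 - p3) ^+ 2) ->
  False.
Proof.
move=> d0 h0 a2p t2p a30 a32 t30 t32 b210 bdh b42le m0 dmb mb42 mslope b31l b31u.
move=> p3lt p20 p2lt X Y X0 XY key Ypos Yneg.
(* Dividing the differences of [a] by [a2], those of [v] by [t2] and each [pj] by [S] divides the
   Lorentzian form by [K] and normalizes [a2 = t2 = 1]. *)
pose K := a2 * t2; have K0 : 0 < K by rewrite mulr_gt0.
pose S := Num.sqrt K; have S0 : 0 < S by rewrite sqrtr_gt0.
have SE : S ^+ 2 = K by rewrite sqr_sqrtr // ltW.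
have a2n := lt0r_neq0 a2p; have t2n := lt0r_neq0 t2p.
have Kn := lt0r_neq0 K0; have Sn := lt0r_neq0 S0.
pose e := Num.sqrt (b21 / K).
have eK : e ^+ 2 * K = b21 by rewrite sqr_sqrtr ?divr_ge0 ?divfK // ltW.
have sqS q : (q / S) ^+ 2 * K = q ^+ 2 by rewrite -SE; field.
have sqSB q q' : (q / S - q' / S) ^+ 2 * K = (q - q') ^+ 2 by rewrite -SE; field.
pose d' := d / a2; pose h' := h / t2; pose k' := 1 - b42 / K.
have XK : ((p1 / S) ^+ 2 - (1 + k' + 2 * d' * h' - e ^+ 2 + 2 * h')) * K = X.
  rewrite mulrBl sqS /X; congr (_ - _).
  rewrite -eK /d' /h' /k' /K; field; exact/andP.
have YK : ((p1 / S) ^+ 2 - (1 - k' + e ^+ 2 + 2 * d')) * K = Y.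
  rewrite mulrBl sqS /Y; congr (_ - _).
  rewrite -eK /d' /h' /k' /K; field; exact/andP.
have e0 : 0 <= e by rewrite sqrtr_ge0.
apply: (first_last_timelike_scaled (d := d') (e := e) (h := h') (k := k')
  (m := m * t2 / a2) (p1 := p1 / S) (p2 := p2 / S) (p3 := p3 / S)
  (r := b31 / K) (x := t3 / t2) (y := a3 / a2)) => //.
- by rewrite divr_ge0 // ltW.
- by rewrite divr_ge0 // ltW.
- rewrite -(ler_pM2r K0) eK; apply: (le_trans bdh).
  by rewrite le_eqVlt; apply/orP; left; apply/eqP; rewrite /d' /h' /K; field; exact/andP.
- by rewrite subr_ge0 ler_pdivrMr // mul1r.
- by rewrite !(divr_gt0, mulr_gt0).
- rewrite -(ler_pM2r K0) -[leRHS]mulrA eK.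
  have -> : d' ^+ 2 * K = d ^+ 2 * (t2 / a2) by rewrite /d' /K; field.
  have -> : m * t2 / a2 * b21 = m * b21 * (t2 / a2) by field.
  by rewrite ler_pM2r // divr_gt0.
- rewrite -(ler_pM2r K0).
  have -> : m * t2 / a2 * K = m * t2 ^+ 2 by rewrite /K; field.
  by have -> : (1 - k') * K = b42 by rewrite /k'; field.
- rewrite -(ler_pM2r a2p).
  have -> : m * t2 / a2 * (1 - t3 / t2) * a2 = m * (t2 - t3) by field; exact/andP.
  by have -> : (1 - a3 / a2) * a2 = a2 - a3 by field.
- by rewrite divr_ge0 // ltW.
- by rewrite ler_pdivrMr // mul1r.
- by rewrite divr_ge0 // ltW.
- by rewrite ler_pdivrMr // mul1r.
- by rewrite -(ler_pM2r K0) eK divfK.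
- rewrite -(ler_pM2r K0) divfK // !mulrDl eK; apply: (le_trans b31u).
  by rewrite le_eqVlt; apply/orP; left; apply/eqP; rewrite /d' /K; field; exact/andP.
- rewrite -(ltr_pM2r K0) sqS; apply: (lt_le_trans p3lt).
  by rewrite le_eqVlt; apply/orP; left; apply/eqP; rewrite /K; field; exact/andP.
- by rewrite divr_gt0.
- rewrite -(ltr_pM2r K0) sqS; apply: le_lt_trans p2lt.
  by rewrite le_eqVlt; apply/orP; left; apply/eqP; rewrite /k' /K; field; exact/andP.
- by rewrite -(pmulr_llt0 _ K0) XK.
- by rewrite -(ltr_pM2r K0) XK YK.
- rewrite -(ltr_pM2r K0) -[ltLHS]mulrA -[ltRHS]mulrA XK YK.
  have -> : p1 / S * Y = a2 * (p1 * Y) / (a2 * S) by field; exact/andP.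
  have -> : (1 + d') * (p2 / S) * X = p2 * ((a2 + d) * X) / (a2 * S).
    by rewrite /d'; field; exact/andP.
  by rewrite ltr_pM2r // invr_gt0 mulr_gt0.
- rewrite -(pmulr_lgt0 _ K0) YK => /Ypos.
  by rewrite -[in X in _ -> X](ltr_pM2r K0) sqSB divfK.
- rewrite -(pmulr_llt0 _ K0) YK => /Yneg h1.
  rewrite -(ler_pM2r K0) sqSB eK => /h1.
  by rewrite -[in X in _ -> X](ltr_pM2r K0) sqSB divfK.
Qed.

(** As [a3 * X3 <= 0] and [a2 <= a1], the second equation gives [y1 * X1 + y2 * X2 >= 0]. With
    [X1 < Y1] and [X2 <= Y2], the first two terms of the first equation then have a positive sum, so
    the third is negative. *)
Lemma last_two_timelike y1 y2 y3 a1 a2 a3 X1 X2 X3 Y1 Y2 Y3 :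
    0 < y1 -> 0 < y2 -> 0 < y3 -> 0 <= a3 -> a2 <= a1 -> 0 < a1 ->
    X1 < Y1 -> X2 <= Y2 -> 0 < X2 -> X3 < 0 ->
    y1 * (X1 + Y1) + y2 * (X2 + Y2) + y3 * (X3 + Y3) = 0 ->
    y1 * (a1 * X1) + y2 * (a2 * X2) + y3 * (a3 * X3) = 0 ->
  X3 + Y3 < 0.
Proof.
move=> y1p y2p y3p a30 a21 a10 XY1 XY2 X20 X30 R1 R2.
rewrite ltNge; apply/negP => D3.
have h3 : y3 * (a3 * X3) <= 0 by rewrite pmulr_rle0 // mulr_ge0_le0 // ltW.
have h2 : (y2 * X2) * a2 <= (y2 * X2) * a1 by rewrite ler_pM2l // mulr_gt0.
have : 0 <= y1 * X1 + y2 * X2.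
  rewrite -(pmulr_rge0 _ a10); clear -R2 h2 h3; lra.
have : 0 <= y3 * (X3 + Y3) by rewrite mulr_ge0 // ltW.
have : y1 * X1 < y1 * Y1 by rewrite ltr_pM2l.
have : y2 * X2 <= y2 * Y2 by rewrite ler_pM2l.
clear -R1; lra.
Qed.

(** In [a2] times the [p]-equation minus [p2] times the [a]-equation, the term at 2 is positive and
    the term at 3 is nonnegative, because [a2 * p3] is at most [a3 * p2] in absolute value. Hence
    the term at 1 is negative. *)
Lemma first_last_key y1 y2 y3 p1 p2 p3 a1 a2 a3 t2 t3 X1 X2 X3 Y1 Y2 Y3 :
    0 < y1 -> 0 < y2 -> 0 < y3 -> 0 < a2 -> 0 <= a3 ->
    a2 * t3 <= a3 * t2 -> a2 * t2 <= p2 ^+ 2 -> p3 ^+ 2 <= a3 * t3 ->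
    X2 < Y2 -> X3 <= Y3 -> X3 + Y3 <= 0 -> 0 < p2 ->
    y1 * (p1 * Y1) + y2 * (p2 * Y2) + y3 * (p3 * Y3) = 0 ->
    y1 * (a1 * X1) + y2 * (a2 * X2) + y3 * (a3 * X3) = 0 ->
  a2 * (p1 * Y1) < p2 * (a1 * X1).
Proof.
move=> y1p y2p y3p a20 a30 conc p2l p3u XY2 XY3 D3 p20 R1 R2.
have sq : (a2 * p3) ^+ 2 <= (a3 * p2) ^+ 2.
  have h1 : a2 ^+ 2 * p3 ^+ 2 <= a2 ^+ 2 * (a3 * t3) by rewrite ler_wpM2l ?sqr_ge0.
  have h2 : (a2 * a3) * (a2 * t3) <= (a2 * a3) * (a3 * t2).
    by rewrite ler_wpM2l // mulr_ge0 // ltW.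
  have h3 : a3 ^+ 2 * (a2 * t2) <= a3 ^+ 2 * p2 ^+ 2 by rewrite ler_wpM2l ?sqr_ge0.
  clear -h1 h2 h3; lra.
have ap : 0 <= a3 * p2 by rewrite mulr_ge0 // ltW.
have ap1 : a2 * p3 <= a3 * p2 by apply: le_of_sqr.
have ap2 : - (a2 * p3) <= a3 * p2 by apply: le_of_sqr; rewrite ?sqrrN.
rewrite -(ltr_pM2l y1p).
have h2 : 0 < y2 * ((a2 * p2) * (Y2 - X2)) by rewrite !mulr_gt0 ?subr_gt0.
have h3 : 0 <= y3 * ((a3 * p2 + a2 * p3) * (Y3 - X3)
    + (a3 * p2 - a2 * p3) * - (X3 + Y3)).
  apply: mulr_ge0; first exact: ltW.
  apply: addr_ge0; apply: mulr_ge0; rewrite ?subr_ge0 ?oppr_ge0 //.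
  by rewrite -(opprK (a2 * p3)) subr_ge0.
have : a2 * (y1 * (p1 * Y1) + y2 * (p2 * Y2) + y3 * (p3 * Y3)) -
  p2 * (y1 * (a1 * X1) + y2 * (a2 * X2) + y3 * (a3 * X3)) = 0.
  by rewrite R1 R2 !mulr0 subrr.
clear -h2 h3; lra.
Qed.

End Inequalities.

(** * Points of K_1 *)

(* With [B] the Bregman divergence of [F], this is [(u - u')^2 - 2 B(v', v)].
   For [T = K1_mx a F u v] and [T' = K1_mx a F u' v'], the three minors of
   [T - T'] are combinations, with coefficients depending on [T] only, of
   [gap T T' + gap T' T], [(u - u') * gap T' T] and [(a v - a v') * gap T T']. *)
Definition gap (R : realType) (a F : R -> R) (u v u' v' : R) : R :=
  (u - u') ^+ 2 + 2 * (F v - F v' - a v * (v - v')).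

Section Core.
Variables (R : realType) (a F : R -> R).
Hypotheses (incr : strictly_increasing a) (cvx : strictly_convex a)
  (antiF : antiderivative F a).
Local Notation gp := (gap a F).

Lemma gapD u v u' v' :
  gp u v u' v' + gp u' v' u v = 2 * ((u - u') ^+ 2 - (a v - a v') * (v - v')).
Proof. by rewrite /gap; ring. Qed.

Lemma gap_lt u v u' v' : v < v' -> gp u' v' u v < gp u v u' v'.
Proof. by move=> vv; have := trapezoid_lt cvx antiF vv; rewrite /gap; lra. Qed.

Lemma gap_le u v u' v' : v <= v' -> gp u' v' u v <= gp u v u' v'.
Proof. by move=> vv; have := trapezoid_le cvx antiF vv; rewrite /gap; lra. Qed.

Lemma no_balanced_quadruple u1 u2 u3 u4 v1 v2 v3 v4 x2 x3 x4 y1 y2 y3 :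
    v1 <= v2 -> v2 <= v3 -> v3 <= v4 -> v1 < v4 ->
    0 < x2 -> 0 < x3 -> 0 < x4 -> 0 < y1 -> 0 < y2 -> 0 < y3 ->
    x2 * (gp u1 v1 u2 v2 + gp u2 v2 u1 v1) + x3 * (gp u1 v1 u3 v3 + gp u3 v3 u1 v1)
      + x4 * (gp u1 v1 u4 v4 + gp u4 v4 u1 v1) = 0 ->
    x2 * ((a v1 - a v2) * gp u1 v1 u2 v2) + x3 * ((a v1 - a v3) * gp u1 v1 u3 v3)
      + x4 * ((a v1 - a v4) * gp u1 v1 u4 v4) = 0 ->
    y1 * (gp u4 v4 u1 v1 + gp u1 v1 u4 v4) + y2 * (gp u4 v4 u2 v2 + gp u2 v2 u4 v4)
      + y3 * (gp u4 v4 u3 v3 + gp u3 v3 u4 v4) = 0 ->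
    y1 * ((u4 - u1) * gp u1 v1 u4 v4) + y2 * ((u4 - u2) * gp u2 v2 u4 v4)
      + y3 * ((u4 - u3) * gp u3 v3 u4 v4) = 0 ->
    y1 * ((a v4 - a v1) * gp u4 v4 u1 v1) + y2 * ((a v4 - a v2) * gp u4 v4 u2 v2)
      + y3 * ((a v4 - a v3) * gp u4 v4 u3 v3) = 0 ->
  False.
Proof.
move=> v12 v23 v34 v14 x2p x3p x4p y1p y2p y3p r11 r12 r41 r42 r43.
have v13 := le_trans v12 v23; have v24 := le_trans v23 v34.
have a12 := incr_le incr v12; have a23 := incr_le incr v23.
have a34 := incr_le incr v34; have a14 := incr v14.
have a13 := incr_le incr v13; have a24 := incr_le incr v24.
have [m m0 supp] := supporting_line v2 incr cvx.
have l12 := support_left incr antiF m0 supp v12.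
have l24 := support_right antiF supp v24.
have s3 := supp v3; have s4 := supp v4.
have slope234 := three_slopes_le cvx v23 v34.
(* The chord over [[v3, v4]] is at least as steep as the one over [[v2, v3]], whose slope is at
   least [m]; for [v3 = v2] this is the supporting line itself. *)
have ms34 : m * (v4 - v3) <= a v4 - a v3.
  have [->|nv23] := eqVneq v3 v2; first lra.
  have v23' : v2 < v3 by rewrite lt_neqAle eq_sym nv23.
  rewrite -(ler_pM2r (_ : 0 < v3 - v2)) ?subr_gt0 //; apply: le_trans slope234.
  have : m * (v3 - v2) * (v4 - v3) <= (a v3 - a v2) * (v4 - v3).
    by rewrite ler_wpM2r ?subr_ge0 //; lra.
  lra.
have D4 u v := gapD u4 v4 u v; have g14 := gap_lt u1 u4 v14.
have g24 := gap_le u2 u4 v24; have g34 := gap_le u3 u4 v34.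
pose E12 := gp u1 v1 u2 v2; pose E13 := gp u1 v1 u3 v3.
pose E14 := gp u1 v1 u4 v4.
have S1 : 0 < x2 * E12 + x3 * E13 + x4 * E14.
  have h2 : x2 * gp u2 v2 u1 v1 <= x2 * E12 by rewrite ler_pM2l // gap_le.
  have h3 : x3 * gp u3 v3 u1 v1 <= x3 * E13 by rewrite ler_pM2l // gap_le.
  have h4 : x4 * gp u4 v4 u1 v1 < x4 * E14 by rewrite ltr_pM2l.
  move: r11; rewrite -/E12 -/E13 -/E14; clear -h2 h3 h4; lra.
have row1 : 0 < E14 -> E13 < 0 /\ 0 < E12.
  apply: (row_signs_first (a2 := a v2 - a v1) (a3 := a v3 - a v1) (a4 := a v4 - a v1)
    x2p x3p x4p) => //; try by rewrite ?subr_ge0 ?subr_gt0 // lerD2r.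
  by rewrite -oppr0 -r12 /E12 /E13 /E14; ring.
have [d14|d14] := lerP 0 (gp u4 v4 u1 v1 + gp u1 v1 u4 v4).
  have E14p : 0 < E14 by rewrite /E14; clear -d14 g14; lra.
  have [E13n E12p] := row1 E14p.
  have d13 : (u1 - u3) ^+ 2 < (a v1 - a v3) * (v1 - v3).
    have := gapD u1 v1 u3 v3; have := gap_le u1 u3 v13.
    move: E13n; rewrite /E13; clear; lra.
  have d14' : (a v4 - a v1) * (v4 - v1) <= (u4 - u1) ^+ 2.
    by move: d14; rewrite D4 pmulr_rge0 // subr_ge0.
  (* The reflection of [u] leaves every gap unchanged, so [sg] may be chosen to make [p1] positive;
     [u4 = u1] would contradict [d14']. *)
  suff sgP sg : sg ^+ 2 = 1 -> 0 < sg * (u4 - u1) -> False.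
    have [h|h|h] := ltgtP 0 (u4 - u1).
    - by apply: (sgP 1); rewrite ?expr1n ?mul1r.
    - by apply: (sgP (-1)); rewrite ?sqrrN ?expr1n ?mulN1r ?oppr_gt0.
    - by move: d14'; rewrite -h expr0n /= leNgt mulr_gt0 ?subr_gt0.
  move=> sg2.
  have sgsq z : (sg * z) ^+ 2 = z ^+ 2 by rewrite exprMn sg2 mul1r.
  apply: (@first_last_spacelike R _ (sg * (u4 - u2)) (sg * (u4 - u3))
    (a v4 - a v1) (a v4 - a v2) (a v4 - a v3) (v4 - v1) (v4 - v2) (v4 - v3)
    (gp u4 v4 u1 v1) (gp u4 v4 u2 v2) (gp u4 v4 u3 v3)
    E14 (gp u2 v2 u4 v4) (gp u3 v3 u4 v4) y1 y2 y3 m);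
    rewrite -?mulrBr ?sgsq ?subr_ge0 ?lerD2l ?lerN2 //.
  - by rewrite -(mulr0 sg) -r42 /E14; ring.
  - have := three_slopes_le cvx v12 v24; clear; lra.
  - by clear -s3; lra.
  - have -> : a v4 - a v1 - (a v4 - a v2) = a v2 - a v1 by ring.
    have -> : u4 - u1 - (u4 - u2) = u2 - u1 by ring.
    apply: (le_trans l12); have -> : 2 * m * (F v2 - F v1 - a v1 * (v2 - v1)) =
      m * (2 * (F v2 - F v1 - a v1 * (v2 - v1))) by ring.
    rewrite ler_pM2l //; move: E12p; rewrite /E12 /gap; clear; lra.
  - have := trapezoid_le cvx antiF v23; have := trapezoid_le cvx antiF v34.
    rewrite /gap; clear; lra.
  - move: d13; clear; lra.
have X1n : gp u4 v4 u1 v1 < 0 by clear -d14 g14; lra.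
have S4 : y1 * gp u4 v4 u1 v1 + y2 * gp u4 v4 u2 v2 + y3 * gp u4 v4 u3 v3 < 0.
  have h2 : y2 * gp u4 v4 u2 v2 <= y2 * gp u2 v2 u4 v4 by rewrite ler_pM2l.
  have h3 : y3 * gp u4 v4 u3 v3 <= y3 * gp u3 v3 u4 v4 by rewrite ler_pM2l.
  have h1 : y1 * gp u4 v4 u1 v1 < y1 * E14 by rewrite ltr_pM2l.
  move: r41; rewrite -/E14; clear -h1 h2 h3; lra.
have [X2p X3n] : 0 < gp u4 v4 u2 v2 /\ gp u4 v4 u3 v3 < 0.
  by apply: (row_signs_last (e1 := gp u4 v4 u1 v1)
    (a1 := a v4 - a v1) (a2 := a v4 - a v2) (a3 := a v4 - a v3)
    y1p y2p y3p) => //; rewrite ?subr_ge0 ?subr_gt0 ?lerD2l ?lerN2.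
(* [X3n] excludes [v3 = v4], for which the gap is a square. *)
have lt34 : v3 < v4.
  rewrite lt_neqAle v34 andbT; apply/eqP => e34; move: X3n.
  by rewrite /gap e34 !subrr mulr0 subr0 mulr0 addr0 ltNge sqr_ge0.
have lt24 := le_lt_trans v23 lt34; have alt24 := incr lt24.
have a40 : 0 < a v4 - a v1 by rewrite subr_gt0.
have d34 : gp u4 v4 u3 v3 + gp u3 v3 u4 v4 < 0.
  apply: (last_two_timelike y1p y2p y3p _ _ a40 g14 g24 X2p X3n r41 r43);
  by rewrite ?subr_ge0 ?lerD2l ?lerN2.
have {}g24 := gap_lt u2 u4 lt24.
have d24 : (a v4 - a v2) * (v4 - v2) <= (u4 - u2) ^+ 2.
  have := D4 u2 v2; clear -X2p g24; lra.
have d34' : (u4 - u3) ^+ 2 < (a v4 - a v3) * (v4 - v3).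
  have := D4 u3 v3; clear -d34; lra.
have b12 : 0 <= F v2 - F v1 - a v1 * (v2 - v1).
  by rewrite subr_ge0 left_rectangle.
suff sgP sg : sg ^+ 2 = 1 -> 0 < sg * (u4 - u2) -> False.
  have [h|h|h] := ltgtP 0 (u4 - u2).
  - by apply: (sgP 1); rewrite ?expr1n ?mul1r.
  - by apply: (sgP (-1)); rewrite ?sqrrN ?expr1n ?mulN1r ?oppr_gt0.
  - by move: d24; rewrite -h expr0n /= leNgt mulr_gt0 ?subr_gt0.
move=> sg2 p20.
have sgsq z : (sg * z) ^+ 2 = z ^+ 2 by rewrite exprMn sg2 mul1r.
have key : (a v4 - a v2) * ((sg * (u4 - u1)) * E14) <
    (sg * (u4 - u2)) * ((a v4 - a v1) * gp u4 v4 u1 v1).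
  apply: (first_last_key (p3 := sg * (u4 - u3)) (a3 := a v4 - a v3)
    (t2 := v4 - v2) (t3 := v4 - v3) y1p y2p y3p _ _ _ _ _ g24 g34 (ltW d34) p20 _ r43);
    rewrite ?sgsq ?subr_gt0 ?subr_ge0 //; first last.
  - by rewrite -(mulr0 sg) -r42 /E14; ring.
  - exact: ltW.
  - clear -slope234; lra.
apply: (@first_last_timelike R (a v2 - a v1) (v2 - v1) m
  (sg * (u4 - u1)) (sg * (u4 - u2)) (sg * (u4 - u3))
  (a v4 - a v2) (a v4 - a v3) (v4 - v2) (v4 - v3)
  (2 * (F v2 - F v1 - a v1 * (v2 - v1))) (2 * (F v3 - F v1 - a v1 * (v3 - v1)))
  (2 * (F v4 - F v2 - a v2 * (v4 - v2)))); rewrite -?mulrBr ?sgsq.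
- by rewrite subr_ge0.
- by rewrite subr_ge0.
- by rewrite subr_gt0.
- by rewrite subr_gt0.
- by rewrite subr_ge0.
- by rewrite lerD2l lerN2.
- by rewrite subr_ge0.
- by rewrite lerD2l lerN2.
- by rewrite mulr_ge0.
- have := trapezoid_le cvx antiF v12; clear; lra.
- have := trapezoid_le cvx antiF v24; clear; lra.
- exact: m0.
- apply: (le_trans l12); clear; lra.
- exact: l24.
- clear -s3; lra.
- have f23 := left_rectangle incr antiF v23.
  have : 0 <= (a v2 - a v1) * (v3 - v2) by rewrite mulr_ge0 ?subr_ge0.
  clear -f23; lra.
- have := trapezoid_le cvx antiF v23; clear; lra.
- exact: d34'.
- exact: p20.
- move: X2p; rewrite /gap; clear; lra.
- move: X1n; rewrite /gap; clear; lra.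
- move: g14; rewrite /gap; clear; lra.
- move: key; rewrite /E14 /gap; clear; lra.
(* The last two goals use the row at point 1: [E14 > 0] forces [E13 < 0] by [row1], and when neither
   [E12] nor [E14] is positive, [E13] must be the positive term of [S1]. *)
- move=> E14p; have [] : E13 < 0 /\ 0 < E12.
    by apply: row1; move: E14p; rewrite /E14 /gap; clear; lra.
  rewrite /E13 /gap; clear; lra.
- move=> E14n E12n; have E14n' : E14 < 0.
    by move: E14n; rewrite /E14 /gap; clear; lra.
  have E12n' : E12 <= 0 by move: E12n; rewrite /E12 /gap; clear; lra.
  have h2 : x2 * E12 <= 0 by rewrite pmulr_rle0.
  have h4 : x4 * E14 < 0 by rewrite pmulr_rlt0.
  have : 0 < E13 by rewrite -(pmulr_rgt0 _ x3p); clear -S1 h2 h4; lra.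
  rewrite /E13 /gap; clear; lra.
Qed.

End Core.

(** * Sorting the four points and translating the minors into gaps *)

Lemma ord4_sorted (R : realType) (v : 'I_4 -> R) :
  exists i1 i2 i3 i4 : 'I_4, [/\ v i1 <= v i2, v i2 <= v i3, v i3 <= v i4,
    i1 != i4 & forall f : 'I_4 -> R, \sum_j f j = f i1 + f i2 + f i3 + f i4].
Proof.
pose s := sort (fun i j => v i <= v j) (enum 'I_4).
have ss : sorted (fun i j => v i <= v j) s by apply: sort_sorted => i j; exact: le_total.
have ps : perm_eq s (enum 'I_4) by apply/permPl; exact: perm_sort.
have us : uniq s by rewrite (perm_uniq ps) enum_uniq.
have zs : size s = 4 by rewrite (perm_size ps) size_enum_ord.
have fs (f : 'I_4 -> R) : \sum_j f j = \sum_(j <- s) f j.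
  by rewrite (perm_big _ ps) /= big_enum.
case: s ss us zs fs {ps} => [|i1 [|i2 [|i3 [|i4 [|]]]]] //=.
rewrite andbT => /and3P[l12 l23 l34] /andP[+ _] _ fs.
rewrite !inE !negb_or => /and3P[_ _ n14].
by exists i1, i2, i3, i4; split=> // f; rewrite fs !big_cons big_nil addr0 !addrA.
Qed.

Lemma TN_gap_sums (R : realType) (a F : R -> R) N (T : 'I_N -> 'M[R]_(3, 2))
    (u v : 'I_N -> R) k :
    (forall i, T i = K1_mx a F (u i) (v i)) -> TN_configuration T ->
    let g i j := gap a F (u i) (v i) (u j) (v j) in
  exists w : 'I_N -> R, [/\ forall j, 0 < w j,
    \sum_j w j * (g k j + g j k) = 0,
    \sum_j w j * ((u k - u j) * g j k) = 0 &
    \sum_j w j * ((a (v k) - a (v j)) * g k j) = 0].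
Proof.
move=> TE /(TN_minor2_sum k)[w w0 wP] g; exists w.
pose S i1 i2 := \sum_j w j * minor2 i1 i2 0 1 (T j - T k).
have S0 i1 i2 : S i1 i2 = 0 by exact: wP.
split=> //.
- transitivity (2 * S 0 1); last by rewrite S0 mulr0.
  rewrite mulr_sumr; apply: eq_bigr => j _.
  by rewrite !TE /minor2 !mxE /= /g /gap; ring.
- transitivity (2 * u k * S 0 1 - 2 * S 0 2); last by rewrite !S0 !mulr0 subrr.
  rewrite !mulr_sumr -sumrB; apply: eq_bigr => j _.
  by rewrite !TE /minor2 !mxE /= /g /gap; field.
- transitivity (2 * a (v k) * S 0 1 + 2 * S 1 2); last by rewrite !S0 !mulr0 addr0.
  rewrite !mulr_sumr -big_split; apply: eq_bigr => j _.
  by rewrite !TE /minor2 !mxE /= /g /gap; field.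
Qed.

Theorem theorem2 (R : realType) (a F : R -> R)
    (a_C2 : C2_fun a) (a_incr : strictly_increasing a)
    (a_convex : strictly_convex a) (F_anti : antiderivative F a) :
  ~ (exists T : 'I_4 -> 'M[R]_(3, 2),
       (forall i : 'I_4, K1 a F (T i)) /\ TN_configuration T).
Proof.
case=> T [TK TN].
have {TK} /choice[uv TE] : forall i, exists p : R * R, T i = K1_mx a F p.1 p.2.
  by move=> i; have [u [v ->]] := TK i; exists (u, v).
pose u i := (uv i).1; pose v i := (uv i).2.
have {}TE i : T i = K1_mx a F (u i) (v i) by rewrite TE.
have [i1 [i2 [i3 [i4 [v12 v23 v34 n14 sumE]]]]] := ord4_sorted v.
have [x [x0 r11 _ r12]] := TN_gap_sums i1 TE TN.
have [y [y0 r41 r42 r43]] := TN_gap_sums i4 TE TN.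
have g0 i : gap a F (u i) (v i) (u i) (v i) = 0.
  by rewrite /gap !subrr mulr0 subr0 expr0n mulr0 addr0.
(* If the extreme [v] agree, so do all four, and each gap is a square; the balance at [i4] then
   forces [u i1 = u i4], against the injectivity of [T]. *)
have v14 : v i1 < v i4.
  rewrite lt_neqAle (le_trans v12) ?(le_trans v23) // andbT.
  apply: contra_neq n14 => v14.
  have v2 : v i2 = v i4 by apply/eqP; rewrite eq_le (le_trans v23) // -v14.
  have v3 : v i3 = v i4 by apply/eqP; rewrite eq_le v34 -v14 (le_trans v12).
  have [_ T_inj _ _] := TN; apply: T_inj; rewrite !TE v14; congr K1_mx.
  have gE i : v i = v i4 -> gap a F (u i4) (v i4) (u i) (v i)
      + gap a F (u i) (v i) (u i4) (v i4) = 2 * (u i4 - u i) ^+ 2.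
    by move=> vi; rewrite gapD vi !subrr mulr0 subr0.
  have sq0 i : 0 <= y i * (2 * (u i4 - u i) ^+ 2).
    by rewrite mulr_ge0 ?(ltW (y0 i)) // mulr_ge0 ?sqr_ge0.
  have : y i1 * (2 * (u i4 - u i1) ^+ 2) == 0.
    rewrite eq_le sq0 andbT -r41 sumE !gE // -!addrA lerDl.
    by rewrite !addr_ge0.
  rewrite mulf_eq0 (gt_eqF (y0 i1)) /= mulf_eq0 pnatr_eq0 /=.
  by rewrite sqrf_eq0 subr_eq0 => /eqP.
move: r11 r12 r41 r42 r43; rewrite !sumE !g0 !addr0 !mulr0 !addr0 !add0r.
by apply: (no_balanced_quadruple a_incr a_convex F_anti v12 v23 v34 v14).
Qed.
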